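(* Let $k\geq 2$, $n\geq 1$ and $r\geq 1$ be integers with $r\leq\frac{(k-1)(2n)}{k}$, and let $\mathcal{F}\subseteq\mathcal{H}^r(M_n)$ be $k$-wise intersecting. Then $$|\mathcal{F}|\leq\begin{cases}2^{r-1}\binom{n-1}{r-1} & \text{if } r\leq n,\\ 2^{2n-r}\binom{n-1}{r-n-1}+2^{2n-r-1}\binom{n-1}{r-n} & \text{otherwise.}\end{cases}$$ If $r<\frac{(k-1)(2n)}{k}$, then equality holds if and only if $\mathcal{F}=\mathcal{H}^r_x(M_n)$ for some vertex $x$ of $M_n$.
   Context: $M_n$ is the perfect matching graph on $2n$ vertices: vertex set $\{1,\dots,2n\}$ and edges $\{i,n+i\}$ for $i=1,\dots,n$. For a graph $G$ and $r\geq1$, $\mathcal{I}^r(G)$ is the family of independent vertex sets of size $r$, $\mathcal{M}^r(G)$ is the family of vertex sets of size $r$ containing a maximum independent set, and $\mathcal{H}^r(G)=\mathcal{I}^r(G)\cup\mathcal{M}^r(G)$. For a vertex $x$, $\mathcal{H}^r_x(G)=\{A\in\mathcal{H}^r(G): x\in A\}$. A family $\mathcal{F}$ is $k$-wise intersecting if $F_1\cap\cdots\cap F_k\neq\emptyset$ for all $F_1,\dots,F_k\in\mathcal{F}$. *)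

(* Defs.v *)
From mathcomp Require Import all_boot.
Set Implicit Arguments. Unset Strict Implicit. Unset Printing Implicit Defensive.

(* Perfect matching graph M_n on 2n vertices: vertex j (1-based) is the
   ordinal j-1 : 'I_(2n); edges {i, n+i}, i.e. ordinals a,b with a + n = b. *)
Definition Madj (n : nat) (a b : 'I_(2 * n)) : bool :=
  (a + n == b :> nat) || (b + n == a :> nat).

Definition independent (n : nat) (A : {set 'I_(2 * n)}) : bool :=
  [forall a in A, forall b in A, ~~ Madj a b].

Definition alpha (n : nat) : nat :=
  \max_(A : {set 'I_(2 * n)} | independent A) #|A|.

Definition max_independent (n : nat) (A : {set 'I_(2 * n)}) : bool :=
  independent A && (#|A| == alpha n).

Definition Ir (n r : nat) : {set {set 'I_(2 * n)}} :=
  [set A : {set 'I_(2 * n)} | independent A & (#|A| == r)].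

Definition Mr (n r : nat) : {set {set 'I_(2 * n)}} :=
  [set A : {set 'I_(2 * n)} | (#|A| == r) && [exists B : {set 'I_(2 * n)}, max_independent B && (B \subset A)]].

Definition Hr (n r : nat) : {set {set 'I_(2 * n)}} := Ir n r :|: Mr n r.

Definition Hrx (n r : nat) (x : 'I_(2 * n)) : {set {set 'I_(2 * n)}} :=
  [set A in Hr n r | x \in A].

Definition kwise_intersecting (T : finType) (k : nat) (F : {set {set T}}) : Prop :=
  forall f : 'I_k -> {set T}, (forall i, f i \in F) ->
    \bigcap_(i < k) f i != set0.

Definition bound (n r : nat) : nat :=
  if r <= n then 2 ^ (r - 1) * 'C(n - 1, r - 1)
  else 2 ^ (2 * n - r) * 'C(n - 1, r - n - 1)
       + 2 ^ (2 * n - r - 1) * 'C(n - 1, r - n).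

(* Main.v *)
Require Import Defs.
From mathcomp Require Import all_boot.
From mathcomp Require Import fingroup perm zify.
Set Implicit Arguments. Unset Strict Implicit. Unset Printing Implicit Defensive.

(* Katona's cycle method. In the cyclic order 0, 1, ..., 2n-1 antipodal points
   are matched, so every arc of length r lies in H^r, and so do its images under
   the automorphisms of M_n, which act transitively on H^r. Put t = 2n - r and
   describe an r-arc by its complementary t-arc; then F is k-wise intersecting
   iff no k complements cover the vertices, and the condition on r reads
   2n <= kt. If the t-arc at 0 is used, each of the t chains j, j+t, j+2t, ...
   (1 <= j <= t) would close up to a cover of the circle by k arcs, so each
   contains an unused start: an automorphism sends at most r of the r-arcs into
   F. Averaging compares |F| with a star.

   In the case of equality with 2n < kt, splicing chains shows that the unused
   starts are consecutive, so for every automorphism g the arcs sent into F are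
   those through some point, which we may rotate to 0 ("g is centered").
   Exchanging the adjacent pairs {i, n+i} and {i+1, n+i+1}, both away from 0,
   keeps g centered: otherwise the complement of a member of F would contain all
   but one end of a t-arc around 0, and k - 1 further t-arcs avoiding 0 would
   complete a cover. Such exchanges (bubble sort) carry every independent set
   containing 0 to an arc, which identifies F with the star of g(0). *)

Lemma window_step (k t : nat) (a : nat -> nat) p :
  (forall i, i.+1 < k -> a i.+1 <= a i + t) -> a 0 <= p -> p < a k.-1 + t ->
  0 < k -> exists2 i, i < k & a i <= p < a i + t.
Proof.
move=> step a0 ak; case: k step ak => // k step /= ak _.
elim: k step ak => [|k IH] step ak; first by exists 0; rewrite // a0.
have [pk|pk] := ltnP p (a k + t).
  by have [//|i ik ip] := IH (fun i ik => step i (ltnW ik)); exists i; rewrite // ltnW.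
exists k.+1 => //; rewrite ak andbT; apply: leq_trans pk; exact: step.
Qed.

Lemma card_window (N y t : nat) : #|[set j : 'I_N | y <= j < y + t]| <= t.
Proof.
rewrite cardE -(size_map val) -[X in _ <= X](size_iota y); apply: uniq_leq_size.
  by rewrite (map_inj_uniq val_inj) enum_uniq.
by move=> _ /mapP[j + ->]; rewrite mem_enum inE mem_iota.
Qed.

Section CyclicChains.
(** [Q j] stands for a used start [j]. Positions go up to [N], which is the start 0 read a second
    time, so that a chain may be cut off at [N]. *)
Variables (k t N : nat) (Q : nat -> bool).
Hypotheses (t_gt0 : 0 < t) (k_gt0 : 0 < k) (ltN : t < N) (leN : N <= k * t) (QN : Q N).
Hypothesis noncover : forall a : nat -> nat,
  (forall i, i < k -> a i <= N) -> (forall i, i < k -> Q (a i)) ->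
  (forall i, i.+1 < k -> a i.+1 <= a i + t) -> a 0 + N <= a k.-1 + t -> False.

(** If every start below [N] in this chain were used, the chain cut off at [N] would be a cover: by
    [leN] its [k] arcs get all the way round, and by [j <= t] the last one meets the first. *)
Lemma chain_gap j : 0 < j <= t ->
  exists i, [&& i < k, j + i * t < N & ~~ Q (j + i * t)].
Proof.
move=> jt; case: (pickP (fun i : 'I_k => (j + i * t < N) && ~~ Q (j + i * t))).
  by move=> i hi; exists i; rewrite ltn_ord.
move=> none; case: (@noncover (fun i => minn (j + i * t) N)).
- by move=> i _; rewrite geq_minr.
- move=> i ik; have := none (Ordinal ik); rewrite /minn /=; case: ltnP => //= _.
  by move/negbFE.
- move=> i _ /=; rewrite mulSn; lia.
- have : N <= t + k.-1 * t by rewrite -mulSn prednK.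
  rewrite /=; lia.
Qed.

Definition gap_at j : nat :=
  if [pick i : 'I_k | (j + i * t < N) && ~~ Q (j + i * t)] is Some i then i else 0.

Lemma gap_atP j : 0 < j <= t ->
  [/\ gap_at j < k, j + gap_at j * t < N & ~~ Q (j + gap_at j * t)].
Proof.
move=> /chain_gap[i /and3P[ik h1 h2]]; rewrite /gap_at; case: pickP.
  by move=> i' /andP[? ?]; split.
by move=> /(_ (Ordinal ik)); rewrite /= h1 h2.
Qed.

Definition gap j : 'I_N := insubd (Ordinal (leq_ltn_trans (leq0n t) ltN)) (j + gap_at j * t).

Lemma gapE j : 0 < j <= t -> gap j = j + gap_at j * t :> nat.
Proof. by move=> /gap_atP[_ h _]; rewrite val_insubd h. Qed.

Lemma gap_inj_on (j j' : nat) : 0 < j <= t -> 0 < j' <= t -> gap j = gap j' :> nat -> j = j'.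
Proof.
move=> hj hj'; rewrite !gapE // => e.
have : (j.-1 + gap_at j * t) %% t = (j'.-1 + gap_at j' * t) %% t by congr (_ %% _); lia.
rewrite ![_ + _ * t]addnC !modnMDl !modn_small; lia.
Qed.

Let gaps : {set 'I_N} := [set gap i.+1 | i : 'I_t].

Lemma card_gaps : #|gaps| = t.
Proof.
rewrite card_imset ?card_ord // => i i' e; apply/val_inj/succn_inj.
by apply: gap_inj_on; rewrite ?ltn_ord // e.
Qed.

Lemma gaps_sub : gaps \subset [set j : 'I_N | ~~ Q j].
Proof.
apply/subsetP=> _ /imsetP[i _ ->]; rewrite inE gapE ?ltn_ord //.
by have [] := @gap_atP i.+1; rewrite ?ltn_ord.
Qed.

Lemma card_compl : #|[set j : 'I_N | Q j]| + #|[set j : 'I_N | ~~ Q j]| = N.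
Proof.
rewrite -[RHS]card_ord -(cardsC [set j : 'I_N | Q j]); congr (_ + _).
by apply: eq_card => j; rewrite !inE.
Qed.

Lemma card_chain : #|[set j : 'I_N | Q j]| <= N - t.
Proof.
have := subset_leq_card gaps_sub; rewrite card_gaps; move: card_compl.
by move: #|_| #|_| => a b; lia.
Qed.

Lemma card_chain_eq : N < k * t -> #|[set j : 'I_N | Q j]| = N - t ->
  exists y, [/\ 0 < y, y + t <= N & forall j : 'I_N, Q j = ~~ (y <= j < y + t)].
Proof.
move=> ltNk cQ.
have eX : [set j : 'I_N | ~~ Q j] = gaps.
  apply/esym/eqP; rewrite eqEcard gaps_sub card_gaps.
  by move: card_compl; rewrite cQ; move: #|_| => a; lia.
have full j i : 0 < j <= t -> j + i * t < N -> i != gap_at j -> Q (j + i * t).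
  move=> hj hN; apply: contraNT => nQ.
  have : Ordinal hN \in gaps by rewrite -eX inE.
  case/imsetP=> i' _ /(congr1 val) /=; have hi' : 0 < i'.+1 <= t by rewrite /= ltn_ord.
  rewrite gapE // => e.
  have ej : j = i'.+1.
    have : (j.-1 + i * t) %% t = (i' + gap_at i'.+1 * t) %% t by congr (_ %% _); lia.
    rewrite ![_ + _ * t]addnC !modnMDl !modn_small //; lia.
  move: e; rewrite ej => /addnI /eqP; rewrite eqn_mul2r; lia.
have minQ j i : 0 < j <= t -> i != gap_at j -> Q (minn (j + i * t) N).
  by move=> hj hi; rewrite /minn; case: ltnP => // h; apply: full.
(* Splicing the chain of [j + 1] before its gap with the chain of [j] after its
   gap produces a covering chain, unless the gaps are nonincreasing. *)
have mono1 j : 0 < j -> j < t -> gap_at j.+1 <= gap_at j.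
  move=> j0 jt; rewrite leqNgt; apply/negP=> lt.
  have [h1 _ _] := @gap_atP j.+1 jt.
  case: (@noncover (fun i => minn ((if i < gap_at j.+1 then j.+1 else j) + i * t) N)).
  - by move=> i _; rewrite geq_minr.
  - by move=> i _; case: ltnP => ?; apply: minQ; lia.
  - by move=> i _ /=; rewrite mulSn; do 2!case: ltnP => ?; lia.
  (* Starting at [j.+1] and ending on the chain of [j] loses one unit when closing up; the strict
     [N < k * t] makes it good. *)
  - have lt' : N < t + k.-1 * t by rewrite -mulSn prednK.
    by rewrite /=; do 2!case: ifP => ?; lia.
(* The multiples of [t] form the chain of [t] with its index raised by one, and serve as the chain
   just before that of 1. *)
have wrap : gap_at 1 <= (gap_at t).+1.
  rewrite leqNgt; apply/negP=> lt.
  have [h1 _ _] := @gap_atP 1 t_gt0.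
  case: (@noncover (fun i => minn ((if i < gap_at 1 then 1 else 0) + i * t) N)).
  - by move=> i _; rewrite geq_minr.
  - move=> i _; case: ltnP => ?; first by apply: minQ; lia.
    have -> : 0 + i * t = t + i.-1 * t by rewrite -mulSn; congr (_ * _); lia.
    apply: minQ; lia.
  - by move=> i _ /=; rewrite mulSn; do 2!case: ltnP => ?; lia.
  - have lt' : N < t + k.-1 * t by rewrite -mulSn prednK.
    by rewrite /=; do 2!case: ifP => ?; lia.
have mono j d : 0 < j -> j + d <= t -> gap_at (j + d) <= gap_at j.
  move=> j0; elim: d => [|d IH] h; first by rewrite addn0.
  rewrite addnS; apply: leq_trans (IH _); [apply: mono1|]; lia.
(* Any two gaps differ by less than [t]: along 1, ..., t the indices never rise, and by [wrap] they
   fall by at most one in total. *)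
have close j j' : 0 < j <= t -> 0 < j' <= t -> gap j' < gap j + t.
  move=> hj hj'; rewrite !gapE //.
  have [le|lt] := leqP j j'.
    have := mono j (j' - j); rewrite subnKC // => h.
    have /leq_mul/(_ (leqnn t)) := h ltac:(lia) ltac:(lia); lia.
  have := mono 1 (j' - 1); rewrite subnKC; last by lia.
  have := mono j (t - j); rewrite subnKC; last by lia.
  move=> h1 h2.
  have h : gap_at j' <= (gap_at j).+1 by lia.
  by have := leq_mul h (leqnn t); rewrite mulSn; lia.
have i0P : 0 < t by [].
pose i0 : 'I_t := [arg min_(i < Ordinal i0P) (gap i.+1 : nat)].
have i0min (i : 'I_t) : gap i0.+1 <= gap i.+1.
  by rewrite /i0; case: arg_minnP => // m _; apply.
pose y : nat := gap i0.+1.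
have hi (i : 'I_t) : 0 < i.+1 <= t by rewrite /= ltn_ord.
have sub : gaps \subset [set j : 'I_N | y <= j < y + t].
  by apply/subsetP=> _ /imsetP[i _ ->]; rewrite inE i0min close.
have e : gaps = [set j : 'I_N | y <= j < y + t].
  by apply/eqP; rewrite eqEcard sub card_gaps card_window.
exists y; split.
- by rewrite /y gapE ?hi //; lia.
(* A window running past [N] would hold fewer than [t] positions. *)
- rewrite leqNgt; apply/negP=> lt.
  have := card_window N y (N - y).
  have -> : [set j : 'I_N | y <= j < y + (N - y)] = gaps.
    by rewrite e; apply/setP=> j; rewrite !inE; have := ltn_ord j; lia.
  by rewrite card_gaps; have := ltn_ord (gap i0.+1); rewrite -/y; lia.
- move=> j; have : (j \in gaps) = ~~ Q j by rewrite -eX inE.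
  by rewrite e inE => ->; rewrite negbK.
Qed.
End CyclicChains.

(** * Images of sets under permutations *)

Lemma mem_imset_perm (T : finType) (g : {perm T}) (A : {set T}) x :
  (x \in g @: A) = ((g^-1)%g x \in A).
Proof. by rewrite -{1}(permKV g x) mem_imset //; apply: perm_inj. Qed.

Lemma imset_perm1 (T : finType) (A : {set T}) : (1%g : {perm T}) @: A = A.
Proof. by apply/setP=> x; rewrite mem_imset_perm invg1 perm1. Qed.

Lemma imset_permM (T : finType) (g h : {perm T}) (A : {set T}) :
  (g * h)%g @: A = h @: (g @: A).
Proof. by apply/setP=> x; rewrite !mem_imset_perm invMg permM. Qed.

Lemma imset_permC (T : finType) (g : {perm T}) (A : {set T}) :
  g @: (~: A) = ~: (g @: A).
Proof. by apply/setP=> x; rewrite !(mem_imset_perm, inE). Qed.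

Lemma card_imset_perm (T : finType) (g : {perm T}) (A : {set T}) :
  #|g @: A| = #|A|.
Proof. by apply: card_imset; apply: perm_inj. Qed.

(** * The matching graph and the members of H^r *)

Section MatchingGraph.
Variable n : nat.
Hypothesis n_gt0 : 0 < n.
Local Notation V := 'I_(2 * n).

Definition part (x : V) : V := insubd x (if x < n then x + n else x - n).

Lemma partE x : part x = (if x < n then x + n else x - n) :> nat.
Proof. rewrite /part val_insubd; have := ltn_ord x; case: (ltnP x n) => ?; case: ifP; lia. Qed.

Lemma partK : involutive part.
Proof.
move=> x; apply: val_inj => /=; rewrite !partE; have := ltn_ord x.
by case: (ltnP x n) => ?; case: ifP; lia.
Qed.

Lemma MadjE (x y : V) : Madj x y = (y == part x).
Proof.
rewrite /Madj -val_eqE /= partE; have := ltn_ord x; have := ltn_ord y.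
by case: (ltnP x n) => ?; lia.
Qed.

Lemma part_neq x : part x != x.
Proof. rewrite -val_eqE /= partE; have := ltn_ord x; case: (ltnP x n) => ?; lia. Qed.

Lemma indepP (A : {set V}) :
  reflect (forall x, x \in A -> part x \notin A) (independent A).
Proof.
apply: (iffP forallP) => [h x xA | h x].
  apply/negP=> pA; have /implyP/(_ xA)/forallP/(_ (part x)) := h x.
  by rewrite pA MadjE eqxx.
apply/implyP=> xA; apply/forallP=> y; apply/implyP=> yA; rewrite MadjE.
by apply: contraTneq yA => ->; apply: h.
Qed.

Lemma part_indep_sub (A : {set V}) : independent A -> part @: A \subset ~: A.
Proof.
move=> /indepP iA; apply/subsetP=> _ /imsetP[x xA ->].
by rewrite inE iA.
Qed.

Lemma card_part (A : {set V}) : #|part @: A| = #|A|.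
Proof. by apply: card_imset; apply: can_inj partK. Qed.

Lemma card_compl_vertices (A : {set V}) : #|~: A| = 2 * n - #|A|.
Proof. by have /(congr1 (subn^~ #|A|)) := cardsC A; rewrite card_ord addKn. Qed.

Lemma indep_card (A : {set V}) : independent A -> #|A| <= n.
Proof.
move=> /part_indep_sub/subset_leq_card; rewrite card_part card_compl_vertices.
by move: #|_| => a; lia.
Qed.

Lemma indepS (A B : {set V}) : A \subset B -> independent B -> independent A.
Proof.
move=> /subsetP sAB /indepP iB; apply/indepP=> x xA.
by apply: contra (iB x (sAB _ xA)); apply: sAB.
Qed.

Lemma indepC (A : {set V}) : independent A -> #|A| = n -> independent (~: A).
Proof.
move=> iA cA; have/indepP iA' := iA; suff <- : part @: A = ~: A.
  apply/indepP=> _ /imsetP[x xA ->]; rewrite partK; apply/imsetP=> -[y yA xy].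
  by have := iA' _ yA; rewrite -xy xA.
apply/eqP; rewrite eqEcard part_indep_sub //= card_part card_compl_vertices cA; lia.
Qed.

Lemma card_choice (A : {set V}) :
  (forall x, (x \in A) = (part x \notin A)) -> #|A| = n.
Proof.
move=> hA; have e : part @: A = ~: A.
  apply/setP=> x; rewrite inE hA negbK -{1}(partK x) mem_imset //.
  exact: can_inj partK.
have := card_compl_vertices A; rewrite -e card_part.
by move: #|_| => a; lia.
Qed.

Lemma choice_sub (A : {set V}) : independent (~: A) ->
  exists2 B : {set V}, independent B && (#|B| == n) & B \subset A.
Proof.
move=> /indepP iA.
(* [A] meets every pair; from a pair inside [A] the vertex below [n] is kept. *)
pose B := [set x in A | (x < n) || (part x \notin A)].
have hB x : (x \in B) = (part x \notin B).
  have := iA x; rewrite !inE partK partE !negbK; have := ltn_ord x.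
  by case: (x \in A); case: (part x \in A); case: (ltnP x n) => //= ? ? h;
    (lia || by move: (h isT)).
exists B; last by apply/subsetP=> x; rewrite inE => /andP[].
rewrite (card_choice hB) eqxx andbT; apply/indepP=> x; rewrite hB; exact.
Qed.

Lemma alphaE : alpha n = n.
Proof.
have [|B /andP[iB /eqP cB] _] := @choice_sub setT.
  by apply/indepP=> x; rewrite !inE.
apply/eqP; rewrite eqn_leq; apply/andP; split.
  by apply/bigmax_leqP=> A /indep_card.
by rewrite -{1}cB /alpha; apply: leq_bigmax_cond.
Qed.

Lemma mem_Hr_small (r : nat) (A : {set V}) : r <= n ->
  (A \in @Hr n r) = independent A && (#|A| == r).
Proof.
move=> rn; rewrite !inE; case: (boolP (_ && _)) => //= nA.
apply: contraNF nA => /andP[cA /existsP[B /andP[/andP[iB /eqP cB] sBA]]].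
suff <- : B = A by rewrite iB cB alphaE eqn_leq rn -{1}alphaE -cB -(eqP cA) subset_leq_card.
by apply/eqP; rewrite eqEcard sBA cB alphaE (eqP cA).
Qed.

(** The complement of a maximum independent set has one vertex of each pair, so it is independent
    too; conversely, a set with independent complement meets every pair. *)
Lemma mem_Hr_large (r : nat) (A : {set V}) : n <= r ->
  (A \in @Hr n r) = independent (~: A) && (#|A| == r).
Proof.
move=> rn; rewrite !inE; apply/idP/idP.
  case/orP=> [/andP[iA /eqP cA] | /andP[cA /existsP[B /andP[/andP[iB /eqP cB] sBA]]]].
    rewrite cA eqxx andbT; apply: indepC => //; have := indep_card iA; lia.
  rewrite cA andbT; move: sBA; rewrite -setCS => /indepS; apply.
  by apply: indepC; rewrite // cB alphaE.
case/andP=> /choice_sub[B /andP[iB cB] sBA] ->.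
by apply/orP; right; apply/existsP; exists B; rewrite /max_independent iB alphaE cB sBA.
Qed.

End MatchingGraph.
Arguments part {n} x.

(** * Arcs, rotations and exchanges of adjacent pairs *)

Section Arcs.
Variable n : nat.
Hypothesis n_gt0 : 0 < n.
Local Notation V := 'I_(2 * n).

(* The cyclic interval {j, ..., j + m - 1} mod 2n; correct only for j <= 2n. *)
Definition carc (m j : nat) : {set V} :=
  [set x : V | (j <= x < j + m) || (x + 2 * n < j + m)].

Lemma mem_arc m j (x : V) :
  (x \in carc m j) = (j <= x < j + m) || (x + 2 * n < j + m).
Proof. by rewrite inE. Qed.

Lemma arc_last m : m <= 2 * n -> carc m (2 * n) = carc m 0.
Proof. by move=> hm; apply/setP=> x; rewrite !mem_arc; have := ltn_ord x; lia. Qed.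

Definition rotv : {perm V} := perm (@ordS_inj (2 * n)).

Lemma rotE (x : V) : rotv x = (if x.+1 < 2 * n then x.+1 else 0) :> nat.
Proof.
rewrite permE /=; case: ltnP => [/modn_small //|h].
have := ltn_ord x => h'; have -> : x.+1 = 2 * n by lia.
by rewrite modnn.
Qed.

Lemma rot_arc m (j : V) : m <= 2 * n -> rotv @: carc m j = carc m (rotv j).
Proof.
move=> hm; apply/setP=> x; rewrite -[x](permKV rotv) mem_imset; last exact: perm_inj.
move: (_ x) => {}x; rewrite !mem_arc !rotE.
by have := ltn_ord x; have := ltn_ord j; repeat case: ifP; lia.
Qed.

Lemma arcC m (j : V) : m < 2 * n -> exists2 i : V, ~: carc m j = carc (2 * n - m) i & 
  (i : nat) = (if j + m < 2 * n then j + m else j + m - 2 * n).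
Proof.
move=> hm; have hi : (if j + m < 2 * n then j + m else j + m - 2 * n) < 2 * n.
  by have := ltn_ord j; case: ifP; lia.
exists (Ordinal hi) => //; apply/setP=> x; rewrite inE !mem_arc /=.
by have := ltn_ord j; have := ltn_ord x; case: ifP; lia.
Qed.

Lemma arc_indep m (j : V) : m <= n -> independent (carc m j).
Proof.
move=> hm; apply/(indepP n_gt0) => x; rewrite !mem_arc (partE n_gt0).
by have := ltn_ord x; have := ltn_ord j; case: (ltnP x n) => ?; lia.
Qed.

Lemma card_arc_le m (j : V) : m <= 2 * n -> #|carc m j| <= m.
Proof.
move=> hm; have hj := ltn_ord j; have [le|lt] := leqP (j + m) (2 * n).
  apply: leq_trans (card_window (2 * n) j m); apply/subset_leq_card/subsetP=> x.
  by rewrite mem_arc inE; have := ltn_ord x; lia.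
pose W1 : {set V} := [set x : V | j <= x < j + (2 * n - j)].
pose W2 : {set V} := [set x : V | 0 <= x < 0 + (j + m - 2 * n)].
have sub : carc m j \subset W1 :|: W2.
  by apply/subsetP=> x; rewrite mem_arc !inE; have := ltn_ord x; lia.
apply: leq_trans (subset_leq_card sub) _; apply: leq_trans (leq_card_setU _ _).1 _.
have := card_window (2 * n) j (2 * n - j); have := card_window (2 * n) 0 (j + m - 2 * n).
rewrite -/W1 -/W2; move: #|W1| #|W2| => a b; lia.
Qed.

Lemma card_arc m (j : V) : m < 2 * n -> #|carc m j| = m.
Proof.
move=> hm; apply/eqP; rewrite eqn_leq card_arc_le ?(ltnW hm) //=.
have [i e _] := arcC j hm; have := @card_arc_le (2 * n - m) i (leq_subr _ _).
by rewrite -e card_compl_vertices; have := card_arc_le j (ltnW hm); move: #|_| => a; lia.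
Qed.

(** The starts of the [m]-arcs through [x] form themselves an [m]-arc, ending at [x]. *)
Lemma card_arcs_through m (x : V) : m < 2 * n -> #|[set j : V | x \in carc m j]| = m.
Proof.
(* The reduction modulo [2 * n] changes the value only when [m = 0]. *)
move=> hm; have hs : (if m <= x.+1 then x.+1 - m else x.+1 + 2 * n - m) %% (2 * n) < 2 * n.
  by rewrite ltn_mod; lia.
rewrite -[RHS](card_arc (Ordinal hs) hm); congr #|pred_of_set _|.
apply/setP=> j; rewrite inE !mem_arc /=; have hj := ltn_ord j; have hx := ltn_ord x.
case: (ltnP 0 m) => [m0|]; last by lia.
by case: (leqP m x.+1) => h; rewrite modn_small; lia.
Qed.

Definition swap_succ (i : V) : {perm V} :=
  (tperm i (rotv i) * tperm (part i) (rotv (part i)))%g.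

Lemma swap_succE (i x : V) : 0 < i -> i.+1 < n ->
  swap_succ i x = (if x == i :> nat then i.+1 else if x == i.+1 :> nat then i : nat
    else if x == i + n :> nat then i.+1 + n
    else if x == i.+1 + n :> nat then i + n else x) :> nat.
Proof.
move=> i0 iN; have e1 : rotv i = i.+1 :> nat by rewrite rotE; case: ifP; lia.
have e2 : part i = i + n :> nat by rewrite (partE n_gt0); case: ifP; lia.
have e3 : rotv (part i) = i.+1 + n :> nat by rewrite rotE e2; case: ifP; lia.
rewrite /swap_succ; move: (part i) (rotv i) (rotv (part i)) e1 e2 e3 => c b a e1 e2 e3.
have hx := ltn_ord x; rewrite permM !permE /= -!val_eqE /= e2 e3.
case: (eqVneq (x : nat) i) => [xi|xi]; first by rewrite e1; repeat case: ifP; lia.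
case: (eqVneq (x : nat) i.+1) => [xi1|xi1]; first by repeat case: ifP; lia.
by repeat case: ifP; lia.
Qed.

Lemma swap_succK (i : V) : 0 < i -> i.+1 < n -> involutive (swap_succ i).
Proof.
move=> i0 iN x; apply: val_inj => /=; rewrite !swap_succE //; have := ltn_ord x.
case: (eqVneq (x : nat) i) => [->|?]; first by repeat case: ifP; lia.
case: (eqVneq (x : nat) i.+1) => [->|?]; first by repeat case: ifP; lia.
case: (eqVneq (x : nat) (i + n)) => [->|?]; first by repeat case: ifP; lia.
case: (eqVneq (x : nat) (i.+1 + n)) => [->|?]; first by repeat case: ifP; lia.
by repeat case: ifP; lia.
Qed.

Definition is_aut (g : {perm V}) := forall x, g (part x) = part (g x).

Lemma is_aut1 : is_aut 1%g.
Proof. by move=> x; rewrite !perm1. Qed.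

Lemma is_autM g h : is_aut g -> is_aut h -> is_aut (g * h)%g.
Proof. by move=> ag ah x; rewrite !permM ag ah. Qed.

Lemma is_autV g : is_aut g -> is_aut g^-1%g.
Proof. by move=> ag x; apply: (@perm_inj _ g); rewrite ag !permKV. Qed.

Lemma is_aut_rot : is_aut rotv.
Proof.
move=> x; apply: val_inj => /=; rewrite !(rotE, partE n_gt0); have := ltn_ord x.
by case: (ltnP x n) => ?; repeat case: ifP; lia.
Qed.

Lemma is_aut_swap_succ (i : V) : 0 < i -> i.+1 < n -> is_aut (swap_succ i).
Proof.
move=> i0 iN x; apply: val_inj => /=; have := ltn_ord x.
rewrite (swap_succE _ i0 iN) !(partE n_gt0) (swap_succE _ i0 iN).
by case: (ltnP x n) => ?; repeat case: ifP; lia.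
Qed.

Lemma aut_indep g (A : {set V}) : is_aut g -> independent A -> independent (g @: A).
Proof.
move=> /is_autV ag /(indepP n_gt0) iA; apply/(indepP n_gt0) => x.
by rewrite !mem_imset_perm ag; apply: iA.
Qed.

Lemma aut_Hr r g (A : {set V}) : is_aut g -> A \in @Hr n r -> g @: A \in @Hr n r.
Proof.
move=> ag; have [rn|rn] := leqP r n.
  rewrite !(mem_Hr_small n_gt0) // card_imset_perm => /andP[/(aut_indep ag) -> ->] //.
rewrite !(mem_Hr_large n_gt0) ?(ltnW rn) // card_imset_perm -imset_permC.
by case/andP=> /(aut_indep ag) -> ->.
Qed.

Lemma rot_ind (P : V -> Prop) (z : V) : z = 0 :> nat -> P z ->
  (forall x, P x -> P (rotv x)) -> forall x, P x.
Proof.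
move=> z0 Pz PS x; have [v] := ubnPeq (x : nat); elim: v x => [|v IH] x xv.
  by have -> : x = z by apply: val_inj; rewrite /= z0; lia.
have hv : v < 2 * n by have := ltn_ord x; lia.
have -> : x = rotv (Ordinal hv).
  by apply: val_inj; rewrite /= rotE /=; have := ltn_ord x; case: ifP; lia.
exact/PS/IH.
Qed.

(** * Sorting an independent set into an arc *)

Section Sorting.
Variable T : {perm V} -> Prop.
Hypotheses (T1 : T 1%g)
  (TM : forall (i : V) g, 0 < i -> i.+1 < n -> T g -> T (g * swap_succ i)%g).

(* A set stable under all sorting exchanges lists, along 1, ..., n-1, first the
   pairs met in i, then the unmet ones, then those met in n+i: it is an arc. *)
Lemma sorted_arc (z : V) (C : {set V}) : z = 0 :> nat -> independent C -> z \in C ->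
  (forall i : V, 0 < i -> i.+1 < n ->
     (rotv i \in C) || (part i \in C) -> (i \in C) || (rotv (part i) \in C)) ->
  exists2 j : V, C = carc #|C| j & z \in carc #|C| j.
Proof.
move=> z0 /(indepP n_gt0) iC zC srt.
pose c v := [exists x : V, (x == v :> nat) && (x \in C)].
have cE (x : V) v : x = v :> nat -> c v = (x \in C).
  move=> <-; apply/existsP/idP => [[y /andP[/eqP/val_inj -> //]]|xC].
  by exists x; rewrite eqxx.
have indc v : v < n -> c v -> ~~ c (v + n).
  move=> vn cv; have v2 : v < 2 * n by lia. 
  rewrite (@cE (part (Ordinal v2))) ?(partE n_gt0) /= ?vn //; apply: iC.
  by rewrite -(@cE _ v).
have c0 : c 0 by rewrite (cE _ _ z0).
have low v : 0 < v -> v.+1 < n -> c v.+1 -> c v.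
  move=> v0 vn cv; have v2 : v < 2 * n by lia.
  have e1 : rotv (Ordinal v2) = v.+1 :> nat by rewrite rotE /=; case: ifP; lia.
  have e2 : part (Ordinal v2) = v + n :> nat by rewrite (partE n_gt0) /=; case: ifP; lia.
  have e3 : rotv (part (Ordinal v2)) = v.+1 + n :> nat by rewrite rotE e2; case: ifP; lia.
  have := srt (Ordinal v2) v0 vn.
  by rewrite -(cE _ _ e1) cv -(cE _ _ e3) (negPf (indc _ vn cv)) orbF -(@cE (Ordinal v2) v) //= => /(_ isT).
have high v : 0 < v -> v.+1 < n -> c (v + n) -> c (v.+1 + n).
  move=> v0 vn cv; have v2 : v < 2 * n by lia.
  have e2 : part (Ordinal v2) = v + n :> nat by rewrite (partE n_gt0) /=; case: ifP; lia.
  have e3 : rotv (part (Ordinal v2)) = v.+1 + n :> nat by rewrite rotE e2; case: ifP; lia.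
  have := srt (Ordinal v2) v0 vn.
  rewrite -(cE _ _ e2) cv -(cE _ _ e3) -(@cE (Ordinal v2) v) //= orbT.
  have nv : ~~ c v by apply: contraTN cv => cv'; apply: indc => //; lia.
  by rewrite (negPf nv) => /(_ isT).
have cn : ~~ c n by have := indc 0 n_gt0 c0; rewrite add0n.
(* [p] will be the last member below [n] and [q] the first above [n], with [2 * n] as a sentinel if
   there is none; [low] and [high] fill in the members between these and the ends. *)
have exp : exists p, (p < n) && c p by exists 0; rewrite n_gt0.
have exq : exists q, (n < q) && (c q || (q == 2 * n)) by exists (2 * n); rewrite eqxx orbT; lia.
have bp p : (p < n) && c p -> p <= n by case/andP; lia.
case: (ex_maxnP exp bp) => p /andP[pn cp] pmax.
case: (ex_minnP exq) => q /andP[qn cq] qmin.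
have q2n : q <= 2 * n by apply: qmin; rewrite eqxx orbT; lia.
have down v d : v + d < n -> c (v + d) -> c v.
  elim: d => [|d IH]; first by rewrite addn0.
  rewrite addnS => h cv; have [vd0|vd0] := posnP (v + d); first by have -> : v = 0 by lia.
  apply: IH; [lia|exact: low].
have up d : q + d < 2 * n -> c (q + d).
  elim: d => [|d IH] h; first by case/orP: cq; rewrite addn0 //; lia.
  have := @high (q + d - n); rewrite subnK; last by lia.
  have -> : (q + d - n).+1 + n = q + d.+1 by lia.
  apply; try lia; apply: IH; lia.
have Cin (x : V) : (x \in C) = (x <= p) || (q <= x).
  rewrite -(@cE x x) //; have hx := ltn_ord x; apply/idP/orP => [cx|[xp|qx]].
  - case: (ltngtP x n) => xn; last by move: cx; rewrite xn (negPf cn).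
      by left; apply: pmax; rewrite xn.
    by right; apply: qmin; rewrite xn cx.
  - by apply: (down x (p - x)); rewrite subnKC.
  - by rewrite -(subnKC qx); apply: up; rewrite subnKC.
pose m := p.+1 + (2 * n - q).
have hm : m < 2 * n by rewrite /m; lia.
have hj : (if q == 2 * n then 0 else q) < 2 * n by case: ifP; lia.
have eC : C = carc m (Ordinal hj).
  apply/setP=> x; rewrite Cin mem_arc /= /m; have := ltn_ord x; case: ifP; lia.
have eM : #|C| = m by rewrite eC card_arc.
by exists (Ordinal hj); rewrite eM -eC.
Qed.

(** [T] is first [is_aut], and later adds the preservation of centered automorphisms. Sorting
    terminates because each exchange lowers the sum of the distances [w v] to 0 along the cycle. *)
Lemma sort_to_arc (z : V) (C : {set V}) : z = 0 :> nat -> independent C -> z \in C ->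
  exists g (j : V), [/\ T g, C = g @: carc #|C| j & z \in carc #|C| j].
Proof.
move=> z0; pose w (v : V) := minn v (2 * n - v).
have [m] := ubnP (\sum_(v in C) w v); elim: m C => // m IH C le_m iC zC.
case: (pickP (fun i : V => [&& 0 < i, i.+1 < n, (rotv i \in C) || (part i \in C),
  i \notin C & rotv (part i) \notin C])) => [i /and5P[i0 iN mv ni nr] | srt].
  pose s := swap_succ i; have sK := swap_succK i0 iN.
  have sV : s^-1%g = s by apply/permP=> x; apply: (@perm_inj _ s); rewrite permKV sK.
  have sz : s z = z by apply: val_inj; rewrite /= swap_succE // z0; repeat case: ifP; lia.
  have [|||g [j [Tg eC zj]]] := IH (s @: C).
  - rewrite ltnS in le_m; apply: leq_trans le_m; rewrite big_imset /=; last by move=> ? ? _ _ /perm_inj.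
    (* Members at [i.+1] and [i + n] move one step toward 0; the places that would move away, [i]
       and [i.+1 + n], are empty. *)
    have decr v : v \in C -> w (s v) <= w v /\ ((v == rotv i) || (v == part i) -> w (s v) < w v).
      have e1 : rotv i = i.+1 :> nat by rewrite rotE; case: ifP; lia.
      have e2 : part i = i + n :> nat by rewrite (partE n_gt0); case: ifP; lia.
      have e3 : rotv (part i) = i.+1 + n :> nat by rewrite rotE e2; case: ifP; lia.
      move=> vC; have vi : v != i :> nat by apply: contraNneq ni => /val_inj <-.
      have vr : v != i.+1 + n :> nat by apply: contraNneq nr; rewrite -e3 => /val_inj <-.
      rewrite -!val_eqE /= e1 e2 /w swap_succE // (negPf vi) (negPf vr).
      by have := ltn_ord v; repeat case: ifP; lia.
    have [v vC hv] : exists2 v, v \in C & (v == rotv i) || (v == part i).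
      by case/orP: mv => ?; [exists (rotv i) | exists (part i)]; rewrite ?eqxx ?orbT.
    rewrite !(bigD1 v vC) /= -addSn leq_add //; first by case: (decr v vC) => _; apply.
    by apply: leq_sum => u /andP[/decr[]].
  - exact/aut_indep/iC/is_aut_swap_succ.
  - by rewrite -sz mem_imset //; apply: perm_inj.
  exists (g * s)%g, j; rewrite card_imset_perm in eC zj; split=> //; first exact: TM.
  by rewrite imset_permM -eC -imset_permM -{1}sV mulVg imset_perm1.
have [|j eC zj] := sorted_arc z0 iC zC; last first.
  by exists 1%g, j; rewrite imset_perm1.
move=> i i0 iN mv; have := srt i; rewrite i0 iN mv /= -negb_or; move/negbFE; exact.
Qed.
End Sorting.
End Arcs.
Arguments rotv {n}.
Arguments carc n m j : clear implicits.

(** * Counting the members of H^r *)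

Lemma card_dep_pairs (S T : finType) (X : {set S}) (Y : S -> {set T}) :
  #|[set p : S * T | (p.1 \in X) && (p.2 \in Y p.1)]| = \sum_(a in X) #|Y a|.
Proof.
rewrite -sum1_card; under eq_bigl do rewrite inE.
rewrite -(pair_big_dep (mem X) (fun a b => b \in Y a) (fun _ _ => 1)) /=.
by apply: eq_bigr => a _; rewrite sum1_card.
Qed.

Section Counting.
Variable n : nat.
Hypothesis n_gt0 : 0 < n.
Local Notation V := 'I_(2 * n).

(** Removing a marked element matches marked independent sets of size [m.+1] with sets of size [m]
    and a marked vertex outside them and their partners, for which there are [2 * (n - m)]
    choices. *)
Lemma card_Ir_succ m : m.+1 * #|@Ir n m.+1| = 2 * (n - m) * #|@Ir n m|.
Proof.
pose P1 := [set p : {set V} * V | (p.1 \in @Ir n m.+1) && (p.2 \in p.1)].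
pose P2 := [set p : {set V} * V | (p.1 \in @Ir n m) && (p.2 \in ~: (p.1 :|: part @: p.1))].
have c1 : #|P1| = m.+1 * #|@Ir n m.+1|.
  rewrite (card_dep_pairs _ (fun A => A)) [RHS]mulnC -sum_nat_const.
  by apply: eq_bigr => A; rewrite inE => /andP[_ /eqP].
have c2 : #|P2| = 2 * (n - m) * #|@Ir n m|.
  rewrite (card_dep_pairs _ (fun A => ~: (A :|: part @: A))) [RHS]mulnC -sum_nat_const.
  apply: eq_bigr => A; rewrite inE => /andP[iA /eqP cA].
  rewrite card_compl_vertices cardsU (card_part n_gt0) cA.
  have -> : A :&: part @: A = set0.
    by apply/eqP; rewrite setI_eq0 disjoint_sym disjoints_subset (part_indep_sub n_gt0).
  by rewrite cards0; lia.
rewrite -c1 -c2; pose f (p : {set V} * V) := (p.1 :\ p.2, p.2).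
have pin (A : {set V}) x : (x \in part @: A) = (part x \in A).
  by rewrite -{1}(partK n_gt0 x) mem_imset //; apply: can_inj (partK n_gt0).
have <- : f @: P1 = P2.
  apply/setP=> -[B x]; rewrite !inE /= pin.
  apply/imsetP/andP=> [[[A y]] | [/andP[iB /eqP cB]]].
    rewrite !inE /= => /andP[/andP[iA /eqP cA] yA] [-> ->].
    split; last by rewrite !inE eqxx /= negb_and (indepP n_gt0 _ iA _ yA) orbT.
    rewrite (indepS n_gt0 _ iA) ?subsetDl //=.
    by have := cardsD1 y A; rewrite yA cA add1n => -[->].
  rewrite negb_or => /andP[xB pxB]; exists (x |: B, x); rewrite /f /= ?setU1K //.
  rewrite !inE eqxx /= cardsU1 xB cB eqxx !andbT.
  apply/(indepP n_gt0) => u; rewrite !inE => /orP[/eqP -> | uB].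
    by rewrite negb_or pxB andbT (part_neq n_gt0).
  rewrite negb_or (indepP n_gt0 _ iB _ uB) andbT.
  by apply: contraNneq pxB => <-; rewrite (partK n_gt0).
rewrite card_in_imset // => -[A x] [B y]; rewrite !inE /= => /andP[_ xA] /andP[_ yB].
by case=> + exy; rewrite -exy => e; congr (_, _) => //; rewrite -(setD1K xA) e exy setD1K.
Qed.

Lemma card_Ir m : #|@Ir n m| = 2 ^ m * 'C(n, m).
Proof.
elim: m => [|m IH].
  rewrite bin0 mul1n; apply/eqP/cards1P; exists set0; apply/setP=> A; rewrite !inE cards_eq0.
  by case: eqP => [->|//]; rewrite ?andbT ?andbF //; apply/(indepP n_gt0) => x; rewrite inE.
apply/eqP; rewrite -(eqn_pmul2l (ltn0Sn m)) card_Ir_succ IH.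
have := mul_bin_left n m; rewrite expnS => e.
by apply/eqP; rewrite [RHS]mulnCA -mulnA -[RHS]mulnA e; lia.
Qed.

Lemma card_Hr r : 0 < r < 2 * n -> 
  #|@Hr n r| = 2 ^ (minn r (2 * n - r)) * 'C(n, minn r (2 * n - r)).
Proof.
move=> r0; rewrite -card_Ir; have [rn|rn] := leqP r n.
  have -> : minn r (2 * n - r) = r by lia.
  by apply: eq_card => A; rewrite (mem_Hr_small n_gt0) // inE.
have -> : minn r (2 * n - r) = 2 * n - r by lia.
rewrite -(card_imset _ (@setC_inj V)); apply: eq_card => A.
rewrite -[A in LHS]setCK mem_imset ?(mem_Hr_large n_gt0) ?(ltnW rn) //; last exact: setC_inj.
rewrite inE setCK card_compl_vertices; congr (_ && _).
have : #|A| <= 2 * n by rewrite -[X in _ <= X](card_ord (2 * n)) max_card.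
by move: #|A| => a; lia.
Qed.

(** This identifies [bound] with the average size of a star, since each member of H^r contains [r]
    of the [2 * n] vertices. *)
Lemma bound_mul r : 0 < r < 2 * n -> 2 * n * bound n r = r * #|@Hr n r|.
Proof.
move=> r0; rewrite card_Hr // /bound; case: leqP => rn.
  have -> : minn r (2 * n - r) = r by lia.
  have := mul_bin_diag n r.-1; rewrite prednK; last by lia.
  have -> : 2 ^ r = 2 * 2 ^ r.-1 by rewrite -expnS prednK; lia.
  rewrite !subn1; move: (2 ^ _) 'C(_, _) 'C(_, _) => w x y e.
  by transitivity (2 * w * (n * y)); [lia | rewrite e; lia].
have -> : minn r (2 * n - r) = 2 * n - r by lia.
set t := 2 * n - r; have t0 : 0 < t by lia.
have -> : 'C(n - 1, r - n - 1) = 'C(n - 1, t).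
  by rewrite -bin_sub; [congr 'C(_, _)|]; lia.
have -> : 'C(n - 1, r - n) = 'C(n - 1, t - 1).
  by rewrite -bin_sub; [congr 'C(_, _)|]; lia.
have := mul_bin_diag n t.-1; have := mul_bin_down n t; rewrite prednK //.
have -> : 2 ^ t = 2 * 2 ^ t.-1 by rewrite -expnS prednK.
rewrite !subn1; move: (2 ^ _) 'C(_, _) 'C(_, _) 'C(_, _) => w x y u.
move=> e1 e2; transitivity (2 * w * (2 * (n * u) + n * x)); first by lia.
rewrite e1 e2 mulnA -mulnDl [RHS]mulnCA; congr (_ * (_ * _)); lia.
Qed.
End Counting.

(* The t-arc around 0 covers all but [e+1, a-1]; after the exchange at i it misses
   p, the preimage of u. The remaining w = (k-1)t points are laid down after the
   value of the conditional, which is chosen by the ends of the arc that moved. *)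
Lemma swap_covered (n t i a e p u w : nat) : 0 < i -> i.+1 < n -> t < 2 * n -> 
  a <= 2 * n -> e.+1 + 2 * n = a + t -> e < u < a ->
  [\/ u = p, (p == i) || (p == i + n) /\ u = p.+1 | (p == i.+1) || (p == i.+1 + n) /\ p = u.+1] ->
  2 * n < w + t -> (t = n -> 2 * n <= w) -> p < 2 * n ->
  (if (e == i) || (e == i + n) then
     if (a == i.+1) || (a == i.+1 + n) then 0 else e.-1
   else e) < p <=
  (if (e == i) || (e == i + n) then
     if (a == i.+1) || (a == i.+1 + n) then 0 else e.-1
   else e) + w.
Proof.
move=> i0 iN tlt ale ea ua pu wt tn pN.
case: ifP => [cE|/negbT cE]; first case: ifP => [cJ|/negbT cJ].
- have tn' : t = n by move: cE cJ; lia.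
  have := tn tn'; case: pu => [<-|[]|[]]; lia.
- move: cE cJ; case: pu => [<-|[]|[]]; lia.
- move: cE; case: pu => [<-|[]|[]].
  + lia.
  + lia.
  + lia.
Qed.

(** * Averaging over the automorphisms *)

Section Averaging.
Variables n r : nat.
Hypotheses (n_gt0 : 0 < n) (r_gt0 : 0 < r) (r_lt : r < 2 * n).
Local Notation V := 'I_(2 * n).
Let t := 2 * n - r.
Let z : V := Ordinal (leq_ltn_trans (leq0n r) r_lt).

Lemma rot_exists (c : V) :
  exists h : {perm V}, [/\ is_aut h, h z = c
    & forall m (j : V), m <= 2 * n -> h @: carc n m j = carc n m (h j)].
Proof.
move: c; apply: (@rot_ind n n_gt0 _ z) => // [|c [h [ah hz hm]]].
  exists 1%g; split=> [||m j _]; [exact: is_aut1 | by rewrite perm1 | by rewrite imset_perm1 perm1].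
exists (h * rotv)%g; split; first exact/is_autM/(is_aut_rot n_gt0).
  by rewrite permM hz.
by move=> m j le; rewrite imset_permM hm // rot_arc // permM.
Qed.

Lemma indep_arc (C : {set V}) : independent C -> 0 < #|C| ->
  exists (g : {perm V}) (j : V), is_aut g /\ C = g @: carc n #|C| j.
Proof.
move=> iC /card_gt0P[x xC]; have [h [ah hz hm]] := rot_exists x.
have [|||g [j [ag eC _]]] := @sort_to_arc n n_gt0 (@is_aut n) (@is_aut1 n) _ z (h^-1%g @: C) erefl.
- by move=> i g i0 iN ag; apply/is_autM => //; apply: is_aut_swap_succ.
- exact/aut_indep/iC/is_autV.
- by rewrite mem_imset_perm invgK hz.
exists (g * h)%g, j; split; first exact: is_autM.
rewrite card_imset_perm in eC.
by rewrite imset_permM -eC -imset_permM mulVg imset_perm1.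
Qed.

(** One of [B] and its complement is independent; that one can be sorted to an arc, and complements
    of arcs are arcs. *)
Lemma Hr_trans (B : {set V}) : B \in @Hr n r ->
  exists2 h : {perm V}, is_aut h & ~: (h @: carc n t z) = B.
Proof.
have [rn|rn] := leqP r n.
  rewrite (mem_Hr_small n_gt0) // => /andP[iB /eqP cB].
  have [|g [j [ag eB]]] := indep_arc iB; first by rewrite cB.
  rewrite cB in eB.
  have [i ei _] := arcC n_gt0 j r_lt; have [h [ah hz hm]] := rot_exists i.
  exists (h * g)%g; first exact: is_autM.
  by rewrite imset_permM hm ?leq_subr // hz -ei imset_permC setCK -eB.
rewrite (mem_Hr_large n_gt0) ?(ltnW rn) // => /andP[iB /eqP cB].
have cC : #|~: B| = t by rewrite card_compl_vertices cB.
have [|g [j [ag eB]]] := indep_arc iB; first by rewrite cC /t; lia.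
rewrite cC in eB.
have [h [ah hz hm]] := rot_exists j.
exists (h * g)%g; first exact: is_autM.
by rewrite imset_permM hm ?leq_subr // hz -eB setCK.
Qed.

Lemma arcC_Hr (j : V) : ~: carc n t j \in @Hr n r.
Proof.
have ht : t < 2 * n by rewrite /t; lia.
have cA : #|~: carc n t j| == r by rewrite card_compl_vertices card_arc // /t; lia.
have [rn|rn] := leqP r n.
  rewrite (mem_Hr_small n_gt0) // cA andbT; have [i -> _] := arcC n_gt0 j ht.
  by apply: arc_indep => //; rewrite /t; lia.
rewrite (mem_Hr_large n_gt0) ?(ltnW rn) // cA andbT setCK.
by apply: arc_indep => //; rewrite /t; lia.
Qed.

Definition Aut : {set {perm V}} := [set g : {perm V} | [forall x, g (part x) == part (g x)]].

Lemma AutP g : reflect (is_aut g) (g \in Aut).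
Proof. by rewrite inE; apply: (iffP forallP) => h x; apply/eqP. Qed.

Definition stab : nat := #|[set g : {perm V} in Aut | ~: (g @: carc n t z) == ~: carc n t z]|.

Lemma stab_gt0 : 0 < stab.
Proof.
apply/card_gt0P; exists 1%g; rewrite inE imset_perm1 eqxx andbT.
exact/AutP/is_aut1.
Qed.

(** Orbit-stabilizer: multiplying by [h] on one side and by the inverse of [b] on the other turns
    the automorphisms counted here into the stabilizer of the [t]-arc at 0. *)
Lemma card_transport (B : {set V}) (j : V) : B \in @Hr n r ->
  #|[set g : {perm V} in Aut | ~: (g @: carc n t j) == B]| = stab.
Proof.
move=> /Hr_trans[b ab <-]; have [h [ah hz hm]] := rot_exists j.
have eh : carc n t j = h @: carc n t z by rewrite hm ?leq_subr ?hz.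
pose f (g : {perm V}) := (h * g * b^-1)%g.
have injf : injective f by move=> g g' /mulIg /mulgI.
rewrite /stab -[RHS](card_preimset _ injf); apply: eq_card => g.
rewrite !inE !(inj_eq (@setC_inj V)); congr (_ && _).
  have conj : is_aut g <-> is_aut (f g).
    split=> ag; first exact: is_autM (is_autM ah ag) (is_autV ab).
    have -> : g = (h^-1 * f g * b)%g by rewrite mulgA mulgKV mulKg.
    exact: is_autM (is_autM (is_autV ah) ag) ab.
  apply/forallP/forallP => ag; have {}ag := fun x => eqP (ag x).
    by have/conj {}ag := ag => x; apply/eqP.
  by have/conj {}ag := ag => x; apply/eqP.
rewrite !imset_permM -eh; apply/eqP/eqP => [-> | <-].
  by rewrite -imset_permM mulgV imset_perm1.
by rewrite -(imset_permM b^-1%g b) mulVg imset_perm1.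
Qed.

Definition arc_starts (F : {set {set V}}) (g : {perm V}) : {set V} :=
  [set j : V | ~: (g @: carc n t j) \in F].

(** Each member of [F] is reached from each of the [2 * n] arcs by exactly [stab] automorphisms. *)
Lemma sum_arc_starts (F : {set {set V}}) : F \subset @Hr n r ->
  \sum_(g in Aut) #|arc_starts F g| = #|F| * (2 * n * stab).
Proof.
move=> /subsetP sF.
transitivity (\sum_(g in Aut) \sum_(j : V) \sum_(B in F) (~: (g @: carc n t j) == B) ).
  apply: eq_bigr => g _; rewrite -sum1_card big_mkcond; apply: eq_bigr => j _.
  rewrite inE; case: ifP => hF.
    by rewrite (bigD1 _ hF) /= eqxx big1 // => B /andP[_ /negPf nB]; rewrite eq_sym nB.
  by rewrite big1 // => B BF; case: eqP => // e; rewrite e BF in hF.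
have -> : 2 * n * stab = \sum_(j : V) stab by rewrite sum_nat_const card_ord.
rewrite -sum_nat_const; under eq_bigr do rewrite exchange_big.
rewrite exchange_big /=; apply: eq_bigr => B BF; rewrite exchange_big /=.
apply: eq_bigr => j _; rewrite -(card_transport j (sF _ BF)) -sum1_card.
under [RHS]eq_bigl do rewrite inE.
by rewrite big_mkcondr; apply: eq_bigr => g _; case: eqP.
Qed.

Lemma mem_Hrx (x : V) (A : {set V}) : (A \in @Hrx n r x) = (A \in @Hr n r) && (x \in A).
Proof. by rewrite [LHS]in_set. Qed.

(** The arcs that [g] sends into the star are those through the preimage of [x], so every term
    equals [r]. *)
Lemma sum_star (x : V) : \sum_(g in Aut) #|arc_starts (@Hrx n r x) g| = #|Aut| * r.
Proof.
rewrite -sum_nat_const; apply: eq_bigr => g /AutP ag.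
have -> : arc_starts (@Hrx n r x) g = ~: [set j : V | (g^-1)%g x \in carc n t j].
  by apply/setP=> j; rewrite [LHS]in_set mem_Hrx -imset_permC aut_Hr ?arcC_Hr //= !(inE, mem_imset_perm).
rewrite card_compl_vertices card_arcs_through /t; lia.
Qed.

Lemma star_sub (x : V) : @Hrx n r x \subset @Hr n r.
Proof. by apply/subsetP=> A; rewrite mem_Hrx => /andP[]. Qed.

(** By [sum_star] all stars have the same size; counting incidences between vertices and H^r then
    gives its value through [bound_mul]. *)
Lemma card_star (x : V) : #|@Hrx n r x| = bound n r.
Proof.
have n2 : 0 < 2 * n by lia.
have cst y : #|@Hrx n r y| = #|@Hrx n r x|.
  apply/eqP; rewrite -(@eqn_pmul2r (2 * n * stab)); last by rewrite muln_gt0 n2 stab_gt0.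
  by rewrite -!sum_arc_starts ?star_sub // !sum_star.
apply/eqP; rewrite -(eqn_pmul2l n2) bound_mul ?r_gt0 //.
have <- : \sum_(y : V) #|@Hrx n r y| = 2 * n * #|@Hrx n r x|.
  by under eq_bigr do rewrite cst; rewrite sum_nat_const card_ord.
have -> : \sum_(y : V) #|@Hrx n r y| = \sum_(y : V) \sum_(A in @Hr n r) (y \in A).
  apply: eq_bigr => y _; rewrite -sum1_card; under eq_bigl do rewrite mem_Hrx.
  by rewrite big_mkcondr; apply: eq_bigr => A _; case: (y \in A).
apply/eqP; rewrite exchange_big [RHS]mulnC -sum_nat_const; apply: eq_bigr => A AH.
have -> : r = #|A|.
  by move: AH; rewrite !inE => /orP[/andP[_ /eqP]|/andP[/eqP]].
by rewrite -sum1_card [RHS]big_mkcond; apply: eq_bigr => y _; case: (y \in A).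
Qed.

(** * The upper bound *)

Section Intersecting.
Variables (k : nat) (F : {set {set V}}).
Hypotheses (k_gt1 : 1 < k) (leN : 2 * n <= k * t).
Hypotheses (sF : F \subset @Hr n r) (kF : kwise_intersecting k F).

Let t_gt0 : 0 < t. Proof. rewrite /t; lia. Qed.
Let t_lt : t < 2 * n. Proof. rewrite /t; lia. Qed.

Lemma noncover (C : 'I_k -> {set V}) :
  (forall i, ~: C i \in F) -> exists x, forall i, x \notin C i.
Proof.
move=> /kF/set0Pn[x /bigcapP h]; exists x => i.
by have := h i isT; rewrite inE.
Qed.

Lemma arcs_noncover (g : {perm V}) (a : nat -> nat) :
  (forall i, i < k -> a i <= 2 * n) ->
  (forall i, i < k -> ~: (g @: carc n t (a i)) \in F) ->
  (forall i, i.+1 < k -> a i.+1 <= a i + t) -> a 0 + 2 * n <= a k.-1 + t -> False.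
Proof.
move=> ale aF step wrap.
have [x hx] := @noncover (fun i => g @: carc n t (a i)) (fun i => aF i (ltn_ord i)).
pose y := (g^-1)%g x; have hy := ltn_ord y.
have a0 := ale 0 (ltnW k_gt1).
(* [p] lifts [y] from the circle to the [2 * n] consecutive integers starting at [a 0]. *)
pose p := if a 0 <= y then y : nat else y + 2 * n.
have p0 : a 0 <= p by rewrite /p; case: (leqP (a 0) y) => ?; lia.
have p1 : p < a k.-1 + t by rewrite /p; case: (leqP (a 0) y) => ?; lia.
have [i ik /andP[]] := window_step step p0 p1 (ltnW k_gt1).
have := hx (Ordinal ik); rewrite mem_imset_perm mem_arc /= -/y.
by have := ale i ik; rewrite /p; case: (leqP (a 0) y) => ?; lia.
Qed.

Lemma card_starts_rot (h g : {perm V}) :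
  (forall m (j : V), m <= 2 * n -> h @: carc n m j = carc n m (h j)) ->
  #|arc_starts F (h * g)%g| = #|arc_starts F g|.
Proof.
move=> hm; rewrite -[RHS](card_preimset _ (@perm_inj _ h)); apply: eq_card => j.
by rewrite !inE imset_permM hm ?leq_subr.
Qed.

(** A rotation brings a used start to 0, hence also to [2 * n], and [card_chain] applies with
    [r = 2 * n - t]. *)
Lemma card_arc_starts (g : {perm V}) : #|arc_starts F g| <= r.
Proof.
have [->|[c]] := set_0Vmem (arc_starts F g); first by rewrite cards0.
rewrite inE => cF; have [h [_ hz hm]] := rot_exists c.
rewrite -(card_starts_rot g hm) -[r in _ <= r](subKn (ltnW r_lt)).
have F0 : ~: ((h * g)%g @: carc n t 0) \in F.
  by rewrite imset_permM (hm t z) ?leq_subr // hz.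
apply: (@card_chain k t (2 * n) (fun j => ~: ((h * g)%g @: carc n t j) \in F)) => //.
- exact: ltnW.
- by rewrite arc_last ?leq_subr.
- exact: arcs_noncover.
Qed.

Lemma card_le_bound : #|F| <= bound n r.
Proof.
have s0 : 0 < 2 * n * stab by rewrite !muln_gt0 stab_gt0 n_gt0.
rewrite -(card_star z) -(leq_pmul2r s0) -!sum_arc_starts ?star_sub // sum_star.
by rewrite -sum_nat_const; apply: leq_sum => g _; apply: card_arc_starts.
Qed.

(** * The case of equality *)

Section Extremal.
Hypotheses (ltN : 2 * n < k * t) (cF : #|F| = bound n r).

(** The sum for [F] equals that for a star, where every term is [r], while no term for [F] exceeds
    [r]. *)
Lemma card_arc_starts_eq g : is_aut g -> #|arc_starts F g| = r.
Proof.
move=> /AutP ag.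
have [_] := leqif_sum (fun g (_ : g \in Aut) => leqif_eq (card_arc_starts g)).
rewrite sum_arc_starts // cF -(card_star z) -sum_arc_starts ?star_sub //.
rewrite sum_star sum_nat_const eqxx.
by move/esym/forall_inP => /(_ g ag)/eqP.
Qed.

(* [centered g]: the r-arcs that g maps into F are exactly those through 0. *)
Definition centered (g : {perm V}) :=
  forall j : V, (~: (g @: carc n t j) \in F) = (z \notin carc n t j).

Lemma exists_centered : exists2 g, is_aut g & centered g.
Proof.
have [|[c]] := set_0Vmem (arc_starts F 1%g).
  by move/(congr1 (fun A : {set V} => #|A|)); rewrite cards0 card_arc_starts_eq;
    [lia | exact: is_aut1].
rewrite inE => c0F; have [h [ah hz hm]] := rot_exists c.
rewrite imset_perm1 in c0F.
have F0 : ~: (h @: carc n t 0) \in F by rewrite (hm t z) ?leq_subr // hz.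
have FN : ~: (h @: carc n t (2 * n)) \in F by rewrite arc_last ?leq_subr.
have cQ : #|[set j : V | ~: (h @: carc n t j) \in F]| = 2 * n - t.
  by rewrite subKn ?(ltnW r_lt) //; apply: card_arc_starts_eq.
have [y [y0 yt Qy]] := @card_chain_eq k t (2 * n) 
  (fun j => ~: (h @: carc n t j) \in F) t_gt0 (ltnW k_gt1) t_lt leN FN (@arcs_noncover h) ltN cQ.
have hc : y + t - 1 < 2 * n by lia.
have [h2 [ah2 hz2 hm2]] := rot_exists (Ordinal hc).
exists (h2 * h)%g; first exact: is_autM.
move=> j; rewrite imset_permM hm2 ?leq_subr // Qy.
rewrite -[z \in _](mem_imset _ _ (@perm_inj _ h2)) hm2 ?leq_subr // hz2 mem_arc /=.
by have hj := ltn_ord (h2 j); congr (~~ _); lia.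
Qed.

(** The points after [v] up to [v + k.-1 * t] are covered by [k - 1] consecutive [t]-arcs avoiding
    0, whose images have complements in [F] by [centered]. Together with [C] these cannot cover
    everything. *)
Lemma centered_uncovered g (C : {set V}) v : centered g -> ~: (g @: C) \in F ->
  exists2 p : V, p \notin C & (p <= v) || (v + k.-1 * t < p).
Proof.
(* The cap [2 * n - t] keeps the arcs from wrapping round to 0. *)
move=> cg CF; have hb m : minn (v + 1 + m * t) (2 * n - t) < 2 * n by rewrite /t; lia.
have [|x hx] := @noncover (fun i : 'I_k => g @: (if i == 0 :> nat then C
  else carc n t (Ordinal (hb i.-1)))).
  move=> i; case: eqP => // _; rewrite cg mem_arc /=.
  by move: t_lt t_gt0; move: (_ * t) => w; lia.
exists ((g^-1)%g x).
  by have := hx (Ordinal (ltnW k_gt1)); rewrite /= mem_imset_perm.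
apply/negPn/negP; rewrite negb_or -ltnNge -leqNgt; set p := (g^-1)%g x => /andP[vp pK].
have m1 := leq_trunc_div (p - v - 1) t; have m2 := ltn_ceil (p - v - 1) t_gt0.
have mk : ((p - v - 1) %/ t).+1 < k.
  suff : (p - v - 1) %/ t < k.-1 by lia.
  by rewrite ltn_divLR //; lia.
have := hx (Ordinal mk); rewrite /= mem_imset_perm mem_arc /= -/p.
have := ltn_ord p; move: m1 m2 t_lt t_gt0; rewrite [_.+1 * t]mulSn; move: (_ %/ _ * t) => w; lia.
Qed.

Lemma centered_swap (i : V) g : 0 < i -> i.+1 < n -> is_aut g ->
  centered g -> centered (swap_succ i * g)%g.
Proof.
move=> i0 iN ag cg; set s := swap_succ i.
have sV : s^-1%g = s.
  by apply/permP=> x; apply: (@perm_inj _ s); rewrite permKV swap_succK.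
have out (j : V) : z \in carc n t j -> ~: ((s * g)%g @: carc n t j) \notin F.
  move=> zj; apply/negP; rewrite imset_permM => CF.
  (* With the start 0 read as [2 * n], the arc around 0 misses exactly the points strictly between
     [e] and [a]. *)
  pose a := if j == 0 :> nat then 2 * n else j.
  pose e := (a + t - 2 * n).-1.
  pose v := if (e == i) || (e == i + n) then
    if (a == i.+1) || (a == i.+1 + n) then 0 else e.-1 else e.
  have [p] := centered_uncovered v cg CF.
  rewrite mem_imset_perm sV mem_arc => out hp.
  have wt : 2 * n < k.-1 * t + t by rewrite addnC -mulSn prednK // ltnW.
  (* For [t = n] the strict inequality forces [k] to be at least 3. *)
  have w2n : t = n -> 2 * n <= k.-1 * t.
    by move=> tn; move: ltN; rewrite tn ltn_pmul2r // leq_pmul2r //; lia.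
  have ale : a <= 2 * n by rewrite /a; have := ltn_ord j; case: ifP; lia.
  have ea : e.+1 + 2 * n = a + t.
    by move: zj; rewrite mem_arc /= /e /a; have := t_gt0; case: ifP; lia.
  have ua : e < s p < a.
    move: (ltn_ord (s p)) out ea; rewrite /a; move: (s p : nat) => u.
    by have := ltn_ord j; case: ifP; lia.
  have pu : [\/ s p = p :> nat, (p == i :> nat) || (p == i + n :> nat) /\ s p = p.+1 :> nat
      | (p == i.+1 :> nat) || (p == i.+1 + n :> nat) /\ p = (s p).+1 :> nat].
    rewrite swap_succE //; repeat case: ifP => [/eqP|_];
      by [constructor 1 | constructor 2; split; lia | constructor 3; split; lia].
  have := swap_covered i0 iN t_lt ale ea ua pu wt w2n (ltn_ord p); rewrite -/v.
  by move: hp; move: (k.-1 * t) => w; lia.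
(* [out] gives one inclusion, and both sets have [r] elements. *)
move=> j; have e : arc_starts F (s * g)%g = [set j : V | z \notin carc n t j].
  apply/eqP; rewrite eqEcard; apply/andP; split.
    apply/subsetP=> j'; rewrite in_set [_ \in [set _ | _]]in_set => hF.
    by apply/negP=> /out; rewrite hF.
  rewrite card_arc_starts_eq; last exact/is_autM/ag/is_aut_swap_succ.
  have -> : [set j : V | z \notin carc n t j] = ~: [set j : V | z \in carc n t j].
    by apply/setP=> j'; rewrite !inE.
  by rewrite card_compl_vertices card_arcs_through // subKn // ltnW.
by move/setP/(_ j): e; rewrite [LHS]in_set [RHS]in_set.
Qed.

(** For [r <= n], members of the star sort to [r]-arcs through 0 and hence lie in [F]. For larger
    [r], the complement of a member of [F] missing [g z] would sort to a [t]-arc through 0, which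
    [centered] excludes. Either inclusion suffices, as the sizes agree. *)
Lemma extremal_star : exists x : V, F = @Hrx n r x.
Proof.
have [g ag cg] := exists_centered; exists (g z).
pose T (p : {perm V}) := is_aut p /\ forall g, is_aut g -> centered g -> centered (p * g)%g.
have T1 : T 1%g by split=> [|g' _]; [exact: is_aut1 | rewrite mul1g].
have TM (i : V) p : 0 < i -> i.+1 < n -> T p -> T (p * swap_succ i)%g.
  move=> i0 iN [ap Tp]; have as_ := is_aut_swap_succ n_gt0 i0 iN.
  split=> [|g' ag' cg']; first exact: is_autM.
  by rewrite -mulgA; apply: Tp; [exact: is_autM | exact: centered_swap].
have back (A : {set V}) : A = g @: (g^-1%g @: A) by rewrite -imset_permM mulVg imset_perm1.
have [rn|rn] := leqP r n.
  apply/esym/eqP; rewrite eqEcard cF card_star leqnn andbT.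
  apply/subsetP=> B; rewrite mem_Hrx (mem_Hr_small n_gt0) // => /andP[/andP[iB /eqP cB] xB].
  have [||p [j [[_ Tp] eB zj]]] := @sort_to_arc n n_gt0 T T1 TM z (g^-1%g @: B) erefl.
  - exact/aut_indep/iB/is_autV.
  - by rewrite mem_imset_perm invgK.
  rewrite card_imset_perm cB in eB zj.
  have [i ei _] := arcC n_gt0 j r_lt.
  rewrite (back B) eB -imset_permM -[carc n r j]setCK ei imset_permC Tp //.
  by rewrite -ei inE negbK.
apply/eqP; rewrite eqEcard cF card_star leqnn andbT; apply/subsetP=> B BF.
have BH := subsetP sF _ BF; rewrite mem_Hrx BH /=; apply/negPn/negP => xB.
move: BH; rewrite (mem_Hr_large n_gt0) ?(ltnW rn) // => /andP[iB /eqP cB].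
have cC : #|~: B| = t by rewrite card_compl_vertices cB.
have [||p [j [[_ Tp] eB zj]]] := @sort_to_arc n n_gt0 T T1 TM z (g^-1%g @: ~: B) erefl.
- exact/aut_indep/iB/is_autV.
- by rewrite mem_imset_perm invgK inE.
rewrite card_imset_perm cC in eB zj.
have := Tp g ag cg j; rewrite zj imset_permM -eB -back setCK BF.
by [].
Qed.
End Extremal.
End Intersecting.
End Averaging.

Theorem theorem1p4 (k n r : nat) (F : {set {set 'I_(2 * n)}}) :
  2 <= k -> 1 <= n -> 1 <= r -> r * k <= (k - 1) * (2 * n) ->
  F \subset @Hr n r -> kwise_intersecting k F ->
  #|F| <= bound n r /\
  (r * k < (k - 1) * (2 * n) ->
     (#|F| = bound n r <-> exists x : 'I_(2 * n), F = @Hrx n r x)).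
Proof.
move=> k2 n0 r0 le sF kF.
have r_lt : r < 2 * n.
  rewrite ltnNge; apply/negP=> h; have := leq_mul h (leqnn k).
  by move: le; rewrite mulnBl mul1n; have := leq_pmull (2 * n) (ltnW k2); lia.
have leN : 2 * n <= k * (2 * n - r).
  by move: le; rewrite mulnBl mulnBr mul1n (mulnC r); have := leq_mul (leqnn k) (ltnW r_lt);
    have := leq_pmull (2 * n) (ltnW k2); lia.
split; first exact: (card_le_bound n0 r0 r_lt k2).
move=> lt; split=> [cF | [x ->]]; last exact: card_star.
apply: (extremal_star n0 r0 r_lt k2 leN sF kF) => //.
by move: lt; rewrite mulnBl mulnBr mul1n (mulnC r); have := leq_mul (leqnn k) (ltnW r_lt);
    have := leq_pmull (2 * n) (ltnW k2); lia.
Qed.
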